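(* Let $S = \{s_1, s_2, \ldots\} \subset \mathbb{N}$, where $s_1, s_2, \ldots$ are distinct, satisfy $d^*(S) = 0$, and let $A$ be a finite alphabet. Then there exists a minimal subshift $X \subset A^{\mathbb{Z}}$ with zero topological entropy such that for every $u \in A^{\mathbb{N}}$ there is $x_u \in X$ with $x_u(s_n) = u(n)$ for all $n \in \mathbb{N}$.
   Context: For a finite set $A$, $A^{\mathbb{Z}}$ carries the product topology and the left shift $\sigma$, $(\sigma x)(n) = x(n+1)$. A subshift is a closed $\sigma$-invariant subset $X \subset A^{\mathbb{Z}}$ (with $\sigma$ restricted to it). It is minimal if for every $x \in X$ the orbit $\{\sigma^n x : n \in \mathbb{Z}\}$ is dense in $X$. For a subshift $X$, $L_n(X)$ denotes the set of words of length $n$ appearing as $x(i+1)\ldots x(i+n)$ for some $x \in X$, $i \in \mathbb{Z}$, and the topological entropy is $h(X,\sigma) = \lim_{n\to\infty} \frac{\ln |L_n(X)|}{n}$. The Banach density of $S \subset \mathbb{N}$ is $d^*(S) = \lim_{n \to \infty} \sup_{k \in \mathbb{N}} \frac{|S \cap \{k, \ldots, k+n-1\}|}{n}$. *)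

(* Defs.v *)
From HB Require Import structures.
From mathcomp Require Import all_boot all_order all_algebra.
From mathcomp Require Import all_classical all_reals all_analysis.
Set Implicit Arguments. Unset Strict Implicit. Unset Printing Implicit Defensive.
Import Order.TTheory GRing.Theory Num.Theory.
Import numFieldNormedType.Exports.
Local Open Scope ring_scope.
Local Open Scope classical_set_scope.

Definition shift (A : Type) (x : int -> A) : int -> A := fun i => x (i + 1).

(* closedness in the product topology (A discrete): x is in X as soon as every
   basic cylinder neighbourhood {y | y i = x i for |i| <= N} of x meets X *)
Definition shift_closed (A : Type) (X : set (int -> A)) : Prop :=
  forall x : int -> A,
    (forall N : nat, exists y, X y /\ forall i : int, (`|i| <= N)%N -> y i = x i) ->
    X x.

Definition is_subshift (A : Type) (X : set (int -> A)) : Prop :=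
  X !=set0 /\ shift_closed X /\
  (forall x, X x -> X (shift x)) /\
  (forall y, X y -> exists x, X x /\ shift x = y).

(* minimal: for every x in X the orbit {sigma^n x : n in Z} is dense in X,
   i.e. meets every cylinder neighbourhood of every point y of X.
   Here (sigma^n x)(i) = x (i + n). *)
Definition minimal_subshift (A : Type) (X : set (int -> A)) : Prop :=
  is_subshift X /\
  forall x y, X x -> X y -> forall N : nat,
    exists n : int, forall i : int, (`|i| <= N)%N -> x (i + n) = y i.

Definition lang (A : finType) (X : set (int -> A)) (n : nat) : {set n.-tuple A} :=
  [set w : n.-tuple A | `[< exists x, X x /\ exists i : int,
      forall j : 'I_n, x (i + (j.+1)%:Z) = tnth w j >]].

Definition zero_entropy (R : realType) (A : finType) (X : set (int -> A)) : Prop :=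
  (fun n : nat => ln (#|lang X n|%:R : R) / n%:R) @ \oo --> (0 : R^o).

Definition window_count (s : nat -> nat) (k n : nat) : nat :=
  \sum_(k <= i < k + n) (`[< exists m, s m = i >] : nat).

Definition banach_density_zero (R : realType) (s : nat -> nat) : Prop :=
  (fun n : nat => sup [set ((window_count s k n)%:R / n%:R : R) | k in [set: nat]])
    @ \oo --> (0 : R^o).

(* Main.v *)
(** Words are built in levels. A word of the next level is a concatenation of
    [m] words of the current one that differs in at most [D] blocks from a
    fixed cyclic listing of all current words. As the set [S] of values of [s]
    has Banach density zero, [m] can be taken so large that [D], while
    negligible compared with [m], still exceeds the number of blocks that [S]
    can meet in any window; so the blocks met by [S] may be chosen freely and
    arbitrary values on [S] can be realised at every level. Since [D] is smaller
    than the number of occurrences of each word in the listing, every word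
    occurs in every word of the next level, which gives minimality; and the
    Hamming ball of radius [D] has cardinality [exp (o (m))], which gives zero
    entropy. *)

Require Import Defs.
From HB Require Import structures.
From mathcomp Require Import all_boot all_order all_algebra.
From mathcomp Require Import all_classical all_reals all_analysis.
From mathcomp Require Import zify ring lra.
Set Implicit Arguments. Unset Strict Implicit. Unset Printing Implicit Defensive.
Import Order.TTheory GRing.Theory Num.Theory.
Import numFieldNormedType.Exports.
Local Open Scope ring_scope.
Local Open Scope classical_set_scope.

(** * Hits of a sparse set in windows and in blocks *)

Definition hit (s : nat -> nat) (z : int) : Prop := exists t, (s t)%:Z = z.

Lemma window_count_le (s : nat -> nat) (k n : nat) : (window_count s k n <= n)%N.
Proof.
rewrite /window_count -[leqRHS](addKn k) -[leqRHS]muln1 -sum_nat_const_nat.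
by apply: leq_sum => i _; case: asbool.
Qed.

Lemma window_count_small (R : realType) (s : nat -> nat) (q : nat) :
  banach_density_zero R s ->
  exists L, forall n, (L <= n)%N -> forall k, (window_count s k n * q <= n)%N.
Proof.
move=> /cvgrPdist_le/(_ (q.+1%:R^-1)) /=.
rewrite invr_gt0 ltr0n => /(_ isT) [L _ HL].
exists L.+1 => n Ln k; have n0 : (0 < n)%N by apply: leq_ltn_trans Ln.
have := HL n (ltnW Ln); rewrite sub0r normrN => /(le_trans (ler_norm _)).
set E := [set _ | _ in _] => supE.
have : (window_count s k n)%:R / n%:R <= sup E.
  apply: ub_le_sup; last by exists k.
  (* The quotients are bounded by 1, so [sup] really dominates them. *)
  exists 1 => _ [k' _ <-].
  by rewrite ler_pdivrMr ?ltr0n // mul1r ler_nat window_count_le.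
move=> /le_trans/(_ supE); rewrite ler_pdivrMr ?ltr0n // mulrC ler_pdivlMr ?ltr0n //.
by rewrite -natrM ler_nat; lia.
Qed.

Lemma sparse_parameters (R : realType) (s : nat -> nat) (n c : nat) :
  banach_density_zero R s -> (0 < n)%N -> (0 < c)%N ->
  exists m D, [/\ (3 <= m)%N, (0 < D)%N, (D * c <= m)%N &
    forall k, (window_count s k (m * n) < D)%N].
Proof.
move=> s0 n0 c0; have [L HL] := window_count_small (2 * n * c)%N s0.
(* Windows of length [m * n = 2 * c * t * n] have at most [t] hits, and [D = t + 1 <= 2 * t] gives
   [D * c <= m]; the summand 2 ensures [3 <= m]. *)
pose t := (L + 2)%N; exists (2 * c * t)%N, t.+1; split; [nia|lia|nia|] => k.
have /HL/(_ k) : (L <= 2 * c * t * n)%N.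
  have : (0 < c * n)%N by rewrite muln_gt0 c0.
  rewrite /t; nia.
rewrite ltnS {2}(_ : 2 * c * t * n = t * (2 * n * c))%N; last by lia.
by rewrite leq_pmul2r; lia.
Qed.

(** One hit chosen in each block of [T] gives distinct points, the blocks being disjoint. As [s] has
    natural values, a window starting at a negative [a] can be replaced by one of the same length
    starting at 0. *)
Lemma hit_blocks_le (s : nat -> nat) (a : int) (m n : nat) (T : pred 'I_m) :
  (forall i, T i -> exists2 j, (j < n)%N & hit s (a + (i * n + j)%N%:Z)) ->
  exists k, (#|T| <= window_count s k (m * n))%N.
Proof.
move=> HT; pose b : nat := `|Num.max a 0|%N; exists b.
have : forall i : 'I_m, exists z : nat, T i ->
    (exists t, s t = z) /\ exists2 j, (j < n)%N & z%:Z = a + (i * n + j)%N%:Z.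
  move=> i; case: (pselect (T i)) => [/HT[j jn [t st]]|]; last by exists 0%N.
  by exists (s t) => _; split; [exists t|exists j].
move=> /choice[g Hg].
have -> : window_count s b (m * n) =
    size [seq i <- index_iota b (b + m * n) | `[< exists t, s t = i >]].
  by rewrite size_filter -sum1_count big_mkcond /=; apply: eq_bigr => i _; case: asbool.
rewrite cardE -(size_map g); apply: uniq_leq_size.
  rewrite map_inj_in_uniq ?enum_uniq // => i i'; rewrite !mem_enum => Ti Ti' gii'.
  have [_ [j jn e]] := Hg i Ti; have [_ [j' jn' e']] := Hg i' Ti'.
  apply/val_inj => /=; move: e; rewrite gii' e' => /addrI[] e.
  have := congr1 (fun z => z %/ n)%N e.
  by rewrite !divnMDl ?divn_small //; lia.
move=> z /mapP[i]; rewrite mem_enum => Ti ->{z}.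
have [hz [j jn e]] := Hg i Ti; rewrite mem_filter; apply/andP; split.
  exact/asboolP.
have im := ltn_ord i.
have : (i * n + j < m * n)%N by nia.
rewrite mem_index_iota /b; lia.
Qed.

(** * Hamming balls and the cyclic listing *)

(** A Chernoff-type weighting: a coordinate has weight 1 if it agrees with [c] and
    [d = 1 / (#|T| * K)] otherwise. A point of the ball has product weight at least [d ^+ D], while
    the total weight is at most [(1 + #|T| * d) ^+ m]. *)
Lemma hamming_ball_card (R : realType) (T : finType) (m D K : nat)
    (c : 'I_m -> T) : (0 < #|T|)%N -> (0 < K)%N ->
  (#|[pred f : {ffun 'I_m -> T} | (#|[pred i | f i != c i]| <= D)%N]|%:R : R)
    <= (#|T| * K)%:R ^+ D * (1 + K%:R^-1) ^+ m.
Proof.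
move=> T0 K0; set B := [pred f | _].
pose d : R := (#|T| * K)%:R^-1.
have NK0 : 0 < (#|T| * K)%:R :> R by rewrite ltr0n muln_gt0 T0.
have d0 : 0 < d by rewrite invr_gt0.
have d1 : d <= 1 by rewrite invf_le1 // ler1n muln_gt0 T0.
pose w (i : 'I_m) t : R := if t == c i then 1 else d.
have w0 i t : 0 <= w i t by rewrite /w; case: ifP => // _; exact: ltW.
have tot : \sum_(f : {ffun 'I_m -> T}) \prod_i w i (f i) <= (1 + K%:R^-1) ^+ m.
  rewrite -(bigA_distr_bigA w) -[X in _ ^+ X](card_ord m) -prodr_const.
  apply: ler_prod => i _; apply/andP; split; first exact: sumr_ge0.
  rewrite (bigD1 (c i)) //= {1}/w eqxx lerD2l.
  apply: (@le_trans _ _ (\sum_(t : T) d)).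
    rewrite [leRHS](bigD1 (c i)) //= -[leLHS]add0r; apply: lerD; first exact: ltW.
    by apply: ler_sum => t /negbTE; rewrite /w => ->.
  rewrite sumr_const /d natrM invfM -[leLHS]mulr_natl mulrA divff ?mul1r //.
  by rewrite pnatr_eq0 -lt0n.
rewrite mulrC -ler_pdivrMr ?exprn_gt0 // -exprVn -/d; apply: le_trans tot.
rewrite mulr_natl -sumr_const [leRHS](bigID (mem B)) /= -[leLHS]addr0; apply: lerD; last first.
  by apply: sumr_ge0 => f _; exact: prodr_ge0.
apply: ler_sum => f; rewrite inE => fB.
rewrite (_ : \prod_i w i (f i) = d ^+ #|[pred i | f i != c i]|); last first.
  rewrite -prodr_const [RHS]big_mkcond /=; apply: eq_bigr => i _.
  by rewrite /w inE; case: eqP.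
by apply: ler_wiXn2l => //; exact: ltW.
Qed.

(** With [c] the listing modulo [#|T|], every [e] occurs at least [D.+1] times, at
    [q * #|T| + enum_rank e] for [q <= D]; omitting [e] costs more than [D] deviations. *)
Lemma cyclic_center (T : finType) (m D : nat) : (0 < #|T|)%N ->
  (#|T| * D.+1 <= m)%N -> exists c : 'I_m -> T,
  forall f : 'I_m -> T, (#|[pred i | f i != c i]| <= D)%N ->
  forall e, exists i, f i = e.
Proof.
move=> T0 mD; exists (fun i => enum_val (Ordinal (ltn_pmod i T0))) => f fD e.
case: (boolP [exists i, f i == e]) => [/existsP[i /eqP fi]|/existsPn fe].
  by exists i.
exfalso; move: fD; apply/negP; rewrite -ltnNge.
have lt (q : 'I_D.+1) : (q * #|T| + enum_rank e < m)%N.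
  apply: (@leq_trans (q.+1 * #|T|)%N); last first.
    by apply: leq_trans mD; rewrite mulnC leq_mul2l ltn_ord orbT.
  by rewrite mulSn addnC ltn_add2r ltn_ord.
pose g q := Ordinal (lt q).
have gi : injective g.
  move=> q q' /(congr1 val) /= /addIn/eqP; rewrite eqn_pmul2r // => /eqP.
  exact: val_inj.
rewrite -[leqLHS]card_ord -(card_codom gi).
apply: subset_leq_card; apply/fintype.subsetP => _ /codomP[q ->]; rewrite inE.
suff -> : Ordinal (ltn_pmod (g q) T0) = enum_rank e by rewrite enum_rankK fe.
by apply: val_inj => /=; rewrite modnMDl modn_small.
Qed.

(** * Levels and the passage to the next one *)

(** Only the values of [word] below [len] matter. Indices are counted rather than words: different
    indices may carry the same word. *)
Record level (A : Type) := Level {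
  len : nat;
  idx : finType;
  word : idx -> nat -> A
}.
Arguments word {A l}.

Definition matches (A : Type) (s : nat -> nat) (v : int -> A) (l : level A)
    (a : int) (e : idx l) : Prop :=
  forall j, (j < len l)%N -> hit s (a + j%:Z) -> word e j = v (a + j%:Z).

Definition universal (A : Type) (s : nat -> nat) (l : level A) : Prop :=
  forall v a, exists e : idx l, matches s v a e.

Definition refines (A : Type) (l l' : level A) : Prop :=
  exists m (sub : idx l' -> nat -> idx l),
    [/\ (3 <= m)%N, len l' = (m * len l)%N,
        forall f j, (j < len l')%N ->
          word f j = word (sub f (j %/ len l)%N) (j %% len l)%N &
        forall f e, exists2 i, (i < m)%N & sub f i = e].

(** Prescribing block number 1 besides matching [v] is what allows matching words to be nested. *)
Definition extends (A : Type) (s : nat -> nat) (l l' : level A) : Prop :=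
  forall v a (e : idx l), matches s v (a + (len l)%:Z) e ->
  exists f : idx l', matches s v a f /\
    forall j, (j < len l)%N -> word f (len l + j)%N = word e j.

(* Blocks meeting the sparse set are free, one more block is prescribed, and
   all the other blocks follow a cyclic listing of the lower level: the number
   of deviations stays below the bound [D]. *)
Lemma next_level (R : realType) (A : Type) (s : nat -> nat) (l : level A) (K : nat) :
  banach_density_zero R s -> (0 < K)%N ->
  (0 < len l)%N -> (0 < #|idx l|)%N -> universal s l ->
  exists l' : level A,
    [/\ refines l l', extends s l l', (0 < #|idx l'|)%N &
        ln (#|idx l'|%:R : R) <= 2 / K%:R * (len l')%:R].
Proof.
move=> s0 K0 n0 N0 univ; set n := len l in n0 *; set N := #|idx l| in N0 *.
(* This constant serves two needs: at least [N * D.+1] blocks for the cyclic listing, and at least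
   [D * (N * K * K)] for the entropy bound. *)
have c0 : (0 < 2 * N * K * K)%N by rewrite !muln_gt0 N0 K0.
have [[|m] [D [m3 D0 Dm wD]]] := sparse_parameters s0 n0 c0; first by [].
have [|c Hc] := @cyclic_center (idx l) m.+1 D N0.
  apply: leq_trans Dm; have : (0 < K * K)%N by rewrite muln_gt0 K0.
  rewrite -/N -!mulnA; nia.
pose B := [pred f : {ffun 'I_m.+1 -> idx l} | (#|[pred i | f i != c i]| <= D)%N].
pose l' := @Level A (m.+1 * n)%N {f | B f}
  (fun f j => word (val f (inord (j %/ n))) (j %% n)%N).
have ext : extends s l l'.
  move=> v a e He.
  have [g Hg] := choice (fun i : 'I_m.+1 => univ v (a + (i * n)%N%:Z)).
  pose hb (i : 'I_m.+1) := `[< exists2 j, (j < n)%N & hit s (a + (i * n + j)%N%:Z) >].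
  have [k hk] : exists k, (#|hb| <= window_count s k (m.+1 * n))%N.
    by apply: (@hit_blocks_le s a) => i /asboolP.
  pose f := [ffun i : 'I_m.+1 => if i == inord 1 then e else if hb i then g i else c i].
  have Bf : B f.
    (* Fewer than [D] blocks are hit, so block number 1 may deviate as well. *)
    rewrite inE; apply: (@leq_trans #|[predU1 (inord 1) & hb]|).
      apply: subset_leq_card; apply/fintype.subsetP => i; rewrite !inE ffunE.
      case: ifP => //= _; rewrite -[i \in hb]/(hb i); case: ifP => //= _.
      by rewrite eqxx.
    rewrite cardU1; apply: (@leq_trans (1 + #|hb|)%N).
      by rewrite leq_add2r leq_b1.
    by rewrite add1n; apply: leq_ltn_trans hk (wD k).
  exists (exist _ f Bf : idx l'); split.
    move=> j jn hj; rewrite /= ffunE.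
    have qm : (j %/ n < m.+1)%N by rewrite ltn_divLR.
    have rn : (j %% n < n)%N by rewrite ltn_pmod.
    case: ifP => [/eqP/(congr1 val)|_].
      rewrite /= !inordK ?(ltnW m3) // => q1.
      move: hj; rewrite (divn_eq j n) q1 mul1n PoszD addrA => hj.
      by rewrite modnDl modn_mod; apply: He.
    case: ifP => [_|/asboolP[]].
      move: hj; rewrite {1 4}(divn_eq j n) PoszD addrA => hj.
      have := Hg (inord (j %/ n)) _ rn.
      by rewrite inordK //; apply.
    by exists (j %% n)%N => //; rewrite inordK // -divn_eq.
  move=> j jn /=; rewrite -/n divnDl ?dvdnn // divnn n0 divn_small // addn0.
  by rewrite ffunE eqxx modnDl modn_small.
have N'0 : (0 < #|idx l'|)%N.
  apply/card_gt0P; have Bc : B (finfun c).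
    by rewrite inE (@eq_card0 _ [pred i | _]) // => i; rewrite !inE ffunE eqxx.
  by exists (exist _ (finfun c) Bc).
exists l'; split => //.
  exists m.+1, (fun (f : idx l') i => val f (inord i)); split => //.
  move=> f e; have [i fi] := Hc (val f) (valP f) e.
  by exists (val i) => //=; rewrite inord_val.
have card : #|idx l'| = #|B| by rewrite card_sub.
have := @hamming_ball_card R (idx l) m.+1 D K c N0 K0; rewrite -/B -card -/N => cardB.
have NK0 : 0 < (N * K)%:R :> R by rewrite ltr0n muln_gt0 N0.
have K1 : 0 < 1 + K%:R^-1 :> R by rewrite addr_gt0 // invr_gt0 ltr0n.
have KR : 0 < K%:R :> R by rewrite ltr0n.
(* As [len l' >= m.+1], a bound by [2 / K * m.+1] suffices: one half is for [D * ln (N * K)], the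
   other for [m.+1 * ln (1 + 1 / K)]. *)
apply: (@le_trans _ _ (2 / K%:R * m.+1%:R)); last first.
  by rewrite ler_wpM2l ?divr_ge0 // ler_nat leq_pmulr.
apply: (@le_trans _ _ (ln ((N * K)%:R ^+ D * (1 + K%:R^-1) ^+ m.+1))).
  by rewrite ler_ln // posrE ?ltr0n // mulr_gt0 ?exprn_gt0.
rewrite lnM ?posrE ?exprn_gt0 // !lnXn //.
have lnK : ln (1 + K%:R^-1) <= K%:R^-1 :> R.
  by apply: le_ln1Dx; apply: (@lt_trans _ _ 0); rewrite ?ltrN10 ?invr_gt0.
have DcR : (D * (N * K * K))%:R <= m.+1%:R :> R.
  by rewrite ler_nat; apply: leq_trans Dm; rewrite leq_mul2l; apply/orP; right; nia.
have lnN : ln ((N * K)%:R) *+ D <= m.+1%:R / K%:R :> R.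
  rewrite ler_pdivlMr //; apply: le_trans DcR; rewrite mulnA [in leRHS]natrM.
  rewrite ler_wpM2r ?ler0n // (natrM _ D) mulr_natl lerMn2r; apply/orP; right.
  by apply: ltW; apply: ln_sublinear.
rewrite -mulrA [2]mulr2n mulrDl mul1r [K%:R^-1 * _]mulrC; apply: lerD => //.
by rewrite -[leLHS]mulr_natl ler_wpM2l.
Qed.

(** * Towers of levels *)

Record tower (A : Type) (s : nat -> nat) (L : nat -> level A) : Prop := Tower {
  tower_len0 : (0 < len (L 0))%N;
  tower_idx_gt0 : forall k, (0 < #|idx (L k)|)%N;
  tower_universal0 : universal s (L 0);
  tower_refines : forall k, refines (L k) (L k.+1);
  tower_extends : forall k, extends s (L k) (L k.+1)
}.

Lemma tower_exists (R : realType) (A : finType) (s : nat -> nat) :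
  (0 < #|A|)%N -> banach_density_zero R s ->
  exists2 L : nat -> level A, tower s L &
    forall k, ln (#|idx (L k.+1)|%:R : R) <= 2 / k.+1%:R * (len (L k.+1))%:R.
Proof.
move=> A0 s0.
pose good (l : level A) := [/\ (0 < len l)%N, (0 < #|idx l|)%N & universal s l].
(* Choice needs a total step function, so a level that is not good gets an arbitrary successor. *)
have : forall p : nat * level A, exists l', good p.2 ->
    [/\ refines p.2 l', extends s p.2 l', (0 < #|idx l'|)%N &
        ln (#|idx l'|%:R : R) <= 2 / p.1.+1%:R * (len l')%:R].
  move=> [k l] /=; case: (pselect (good l)) => [[l0 i0 ul]|]; last by exists l.
  by have [l' ?] := next_level s0 (ltn0Sn k) l0 i0 ul; exists l'.
move=> /choice[F HF].
pose L := nat_rect (fun=> level A) (@Level A 1 A (fun a _ => a)) (fun k l => F (k, l)).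
have gL k : good (L k).
  elim: k => [|k gk]; first split => //.
    by move=> v a; exists (v a) => -[|//] _ _; rewrite addr0.
  have [[m [sub [m3 lenE _ _]]] ext i0 _] := HF (k, L k) gk; split => //.
    by rewrite [len _]lenE muln_gt0 (leq_trans _ m3) //=; case: gk.
  (* Universality passes up: a word of level [k] matching [v] at the place of block number 1 exists
     and extends. *)
  move=> v a; have [_ _ /(_ v (a + (len (L k))%:Z))[e He]] := gk.
  by have [f [Hf _]] := ext v a e He; exists f.
exists L => [|k]; last by case: (HF (k, L k) (gL k)).
split; [by []|by move=> k; case: (gL k)|by case: (gL 0)| |] => k.
- by case: (HF (k, L k) (gL k)).
- by case: (HF (k, L k) (gL k)).
Qed.

Lemma tower_len_gt0 (A : Type) (s : nat -> nat) (L : nat -> level A) (k : nat) :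
  tower s L -> (0 < len (L k))%N.
Proof.
move=> tL; elim: k => [|k IH]; first exact: tower_len0 tL.
have [m [sub [m3 -> _ _]]] := tower_refines tL k.
by rewrite muln_gt0 IH (leq_trans _ m3).
Qed.

Lemma word_occurs (A : Type) (s : nat -> nat) (L : nat -> level A) (k : nat)
    (e : idx (L k)) (f : idx (L k.+1)) : tower s L ->
  exists2 p, (p + len (L k) <= len (L k.+1))%N &
    forall j, (j < len (L k))%N -> word f (p + j)%N = word e j.
Proof.
move=> tL; have [m [sub [m3 lenE subE /(_ f e)[i im fi]]]] := tower_refines tL k.
have n0 := tower_len_gt0 k tL.
have pn : (i * len (L k) + len (L k) <= len (L k.+1))%N.
  by rewrite lenE addnC -mulSn leq_mul2r im orbT.
exists (i * len (L k))%N => // j jn; rewrite subE; last first.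
  by apply: leq_trans pn; rewrite ltn_add2l.
by rewrite divnMDl // divn_small // addn0 fi modnMDl modn_small.
Qed.

Lemma word_occurs_above (A : Type) (s : nat -> nat) (L : nat -> level A)
    (k K : nat) (e : idx (L k)) : tower s L -> (k <= K)%N ->
  exists (f : idx (L K)) p, (p + len (L k) <= len (L K))%N /\
    forall j, (j < len (L k))%N -> word f (p + j)%N = word e j.
Proof.
move=> tL; elim: K => [|K IH].
  by case: k e => // e _; exists e, 0%N; split.
rewrite leq_eqVlt => /predU1P[<-|/IH[f [p [pK fE]]]]; first by exists e, 0%N; split.
have /card_gt0P[f' _] := tower_idx_gt0 tL K.+1.
have [p' pK' fE'] := word_occurs f f' tL.
exists f', (p' + p)%N; split; first lia.
by move=> j jn; rewrite -addnA fE' ?fE //; lia.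
Qed.

Lemma word_decomposition (A : Type) (s : nat -> nat) (L : nat -> level A)
    (k K : nat) : tower s L -> (k <= K)%N ->
  (exists2 q, (0 < q)%N & len (L K) = (q * len (L k))%N) /\
  forall e : idx (L K), exists g : nat -> idx (L k),
    forall j, (j < len (L K))%N ->
      word e j = word (g (j %/ len (L k))%N) (j %% len (L k))%N.
Proof.
move=> tL.
have base : forall k', (exists2 q, (0 < q)%N & len (L k') = (q * len (L k'))%N) /\
    forall e : idx (L k'), exists g : nat -> idx (L k'),
    forall j, (j < len (L k'))%N ->
      word e j = word (g (j %/ len (L k'))%N) (j %% len (L k'))%N.
  move=> k'; split; first by exists 1%N; rewrite ?mul1n.
  by move=> e; exists (fun=> e) => j jn; rewrite modn_small.
elim: K => [|K IH]; first by case: k.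
rewrite leq_eqVlt => /predU1P[->//|/IH[[q q0 qE] dec]].
have [m [sub [m3 lenE subE _]]] := tower_refines tL K.
split; first by exists (m * q)%N; [rewrite muln_gt0 q0 (leq_trans _ m3)|rewrite lenE qE mulnA].
move=> e; have [g gE] := choice dec.
(* A block of level [K] consists of [q] blocks of level [k], so block [i] of level [k] is number
   [i %% q] inside block [i %/ q]. *)
exists (fun i => g (sub e (i %/ q)%N) (i %% q)%N) => j jK.
rewrite subE // gE ?ltn_pmod ?(tower_len_gt0 _ tL) // qE.
rewrite modn_divl -divnMA [(_ * q)%N]mulnC; congr (word _ _).
by rewrite modn_dvdm // dvdn_mull.
Qed.

(** * The subshift of a tower and its minimality *)

Definition tower_subshift (A : Type) (L : nat -> level A) : set (int -> A) :=
  fun x => forall (a : int) n, exists k (e : idx (L k)) p,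
    (p + n <= len (L k))%N /\ forall i, (i < n)%N -> x (a + i%:Z) = word e (p + i)%N.

Lemma tower_subshift_above (A : Type) (s : nat -> nat) (L : nat -> level A) x
    (k : nat) (a : int) (n : nat) : tower s L -> tower_subshift L x ->
  exists K, (k <= K)%N /\ exists (e : idx (L K)) p,
    (p + n <= len (L K))%N /\ forall i, (i < n)%N -> x (a + i%:Z) = word e (p + i)%N.
Proof.
move=> tL /(_ a n)[k' [e [p [pn xE]]]].
have [f [p' [pn' fE]]] := word_occurs_above e tL (leq_maxr k k').
exists (maxn k k'); split; first exact: leq_maxl.
exists f, (p' + p)%N; split; first lia.
by move=> i ni; rewrite xE // -addnA fE //; lia.
Qed.

(** A window of length [2 * n] contains a complete aligned block of level [k.+1], and every such
    block contains [e]. *)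
Lemma tower_word_recurs (A : Type) (s : nat -> nat) (L : nat -> level A) x
    (k : nat) (e : idx (L k)) : tower s L -> tower_subshift L x ->
  exists b : int, forall j, (j < len (L k))%N -> x (b + j%:Z) = word e j.
Proof.
move=> tL Xx; set n := len (L k.+1).
have [K [kK [f [p [pn xE]]]]] := tower_subshift_above k.+1 0 (2 * n) tL Xx.
have [_ /(_ f)[g gE]] := word_decomposition tL kK; rewrite -/n in gE.
have n0 : (0 < n)%N := tower_len_gt0 k.+1 tL.
(* The first aligned block starting after [p]; it ends no later than [p + 2 * n]. *)
pose q := (p %/ n).+1.
have [r rn rE] := word_occurs e (g q) tL; rewrite -/n in rn.
have pE := divn_eq p n; have pm := ltn_pmod p n0.
exists ((q * n + r)%N%:Z - p%:Z) => j jn.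
have qn : (q * n = p %/ n * n + n)%N by rewrite /q mulSn addnC.
have -> : (q * n + r)%N%:Z - p%:Z + j%:Z = 0 + (q * n + r + j - p)%N%:Z by lia.
rewrite xE; last by lia.
rewrite (_ : p + _ = q * n + (r + j))%N; last by lia.
rewrite gE; last by lia.
rewrite divnMDl // divn_small; last by lia.
by rewrite addn0 modnMDl modn_small ?rE //; lia.
Qed.

Lemma tower_subshift_minimal (A : Type) (s : nat -> nat) (L : nat -> level A) :
  tower s L -> tower_subshift L !=set0 -> minimal_subshift (tower_subshift L).
Proof.
move=> tL X0; split; last first.
  move=> x y Xx Xy N.
  have [k [e [p [pn yE]]]] := Xy (- N%:Z) (2 * N).+1.
  have [b xE] := tower_word_recurs e tL Xx.
  exists (b + p%:Z + N%:Z) => i iN.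
  have [j ji] : exists j : nat, i = - N%:Z + j%:Z.
    by exists (absz (i + N%:Z)); lia.
  rewrite ji yE; last by lia.
  rewrite -xE; last by lia.
  by congr x; lia.
split => //; split; last split.
- move=> x Hx a n; have [y [Xy yx]] := Hx (`|a| + n)%N.
  have [k [e [p [pn yE]]]] := Xy a n; exists k, e, p; split => // i ni.
  by rewrite -yx ?yE //; lia.
- move=> x Xx a n; have [k [e [p [pn xE]]]] := Xx (a + 1) n.
  exists k, e, p; split => // i ni; rewrite -xE // /shift; congr x; lia.
- move=> y Xy; exists (fun i => y (i - 1)); split.
    move=> a n; have [k [e [p [pn yE]]]] := Xy (a - 1) n.
    exists k, e, p; split => // i ni; rewrite -yE //; congr y; lia.
  by rewrite /shift; apply/funext => i; congr y; lia.
Qed.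

(** * Points with prescribed values on the sparse set *)

(** Left end of the word chosen at level [k], placed so that block number 1 of the word of level
    [k.+1] starts at [origin L k]. *)
Fixpoint origin (A : Type) (L : nat -> level A) (k : nat) : int :=
  if k is k'.+1 then origin L k' - (len (L k'))%:Z else 0.

(** Among at least three blocks, block number 1 has a neighbour on either side, so each level gains
    at least one position at both ends. *)
Lemma origin_bounds (A : Type) (s : nat -> nat) (L : nat -> level A) (k : nat) :
  tower s L -> origin L k <= - k%:Z /\ k%:Z < origin L k + (len (L k))%:Z.
Proof.
move=> tL; elim: k => [|k [IHl IHr]] /=; first by have := tower_len_gt0 0 tL; lia.
have [m [_ [m3 lenE _ _]]] := tower_refines tL k.
have : (3 * len (L k) <= len (L k.+1))%N by rewrite lenE leq_mul2r m3 orbT.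
have := tower_len_gt0 k tL; lia.
Qed.

(* The word chosen at level [k] is block number 1, neither the first nor the
   last one, of the word chosen at level [k.+1], so the chosen words exhaust
   both ends of the line. *)
Lemma tower_interpolates (A : Type) (s : nat -> nat) (L : nat -> level A)
    (v : int -> A) : tower s L ->
  exists2 x, tower_subshift L x & forall z, hit s z -> x z = v z.
Proof.
move=> tL.
pose W k := {e : idx (L k) | matches s v (origin L k) e}.
have next k (e : W k) : {f : W k.+1 | forall j, (j < len (L k))%N ->
    word (sval f) (len (L k) + j)%N = word (sval e) j}.
  apply: cid; have [|f [Hf fE]] := tower_extends tL (a := origin L k.+1) (e := sval e) (v := v).
    by rewrite /= subrK; exact: svalP e.
  by exists (exist _ f Hf).
have [e0 He0] := cid (tower_universal0 tL v 0).
pose E := nat_rect W (exist _ e0 He0) (fun k e => sval (next k e)).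
have EE k j : (j < len (L k))%N ->
    word (sval (E k.+1)) (len (L k) + j)%N = word (sval (E k)) j.
  exact: (svalP (next k (E k))).
have coh k K z : (k <= K)%N -> origin L k <= z -> z < origin L k + (len (L k))%:Z ->
    [/\ origin L K <= z, z < origin L K + (len (L K))%:Z &
    word (sval (E K)) (absz (z - origin L K)) = word (sval (E k)) (absz (z - origin L k))].
  move=> + zl zr; elim: K => [|K IH]; first by case: k zl zr.
  rewrite leq_eqVlt => /predU1P[<-//|/IH[Kl Kr <-]].
  have [m [_ [m3 lenE _ _]]] := tower_refines tL K.
  have lenK : (3 * len (L K) <= len (L K.+1))%N by rewrite lenE leq_mul2r m3 orbT.
  have oK : origin L K.+1 = origin L K - (len (L K))%:Z by [].
  split; [lia|lia|].
  rewrite (_ : absz (z - origin L K.+1) = len (L K) + absz (z - origin L K))%N; last by lia.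
  by apply: EE; lia.
(* By [origin_bounds] the word of level [|z|] already covers [z]; by [coh] every higher level gives
   the same letter. *)
pose x z := word (sval (E `|z|%N)) (absz (z - origin L `|z|%N)).
have xE z K : (`|z| <= K)%N -> x z = word (sval (E K)) (absz (z - origin L K)).
  move=> zK; have [zl zr] := origin_bounds `|z|%N tL.
  by have [||_ _ ->] := coh _ _ z zK; [lia|lia|].
exists x => [a n|z hz].
  pose K := (`|a| + n)%N; have [Kl Kr] := origin_bounds K tL.
  exists K, (sval (E K)), (absz (a - origin L K)); split; first by rewrite /K in Kl Kr *; lia.
  move=> i ni; rewrite (@xE _ K); last by rewrite /K; lia.
  by congr word; rewrite /K in Kl Kr *; lia.
have [zl zr] := origin_bounds `|z|%N tL.
rewrite /x; have zE : origin L `|z| + (absz (z - origin L `|z|))%:Z = z by lia.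
by rewrite (svalP (E `|z|%N)) ?zE //; lia.
Qed.

(** * Counting words and entropy *)

(** A word of length [n] is determined by its offset in the first block of level [k] and by the at
    most [n %/ len (L k) + 2] blocks that it meets. *)
Lemma lang_card_le (A : finType) (s : nat -> nat) (L : nat -> level A) (k n : nat) :
  tower s L ->
  (#|lang (tower_subshift L) n| <=
    len (L k) * #|idx (L k)| ^ (n %/ len (L k)).+2)%N.
Proof.
move=> tL; set l := len (L k); set T := idx (L k).
have l0 : (0 < l)%N := tower_len_gt0 k tL.
pose Q := (n %/ l).+2.
pose phi (rh : 'I_l * {ffun 'I_Q -> T}) : n.-tuple A :=
  [tuple word (rh.2 (inord ((rh.1 + j) %/ l)%N)) ((rh.1 + j) %% l)%N | j < n].
have -> : (l * #|T| ^ Q)%N = #|{: 'I_l * {ffun 'I_Q -> T}}|.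
  by rewrite card_prod card_ffun !card_ord.
apply: leq_trans (leq_imset_card phi _); apply: subset_leq_card.
apply/fintype.subsetP => w; rewrite inE => /asboolP[x [Xx [i xw]]].
have [K [kK [e [p [pn xE]]]]] := tower_subshift_above k (i + 1) n tL Xx.
have [_ /(_ e)[g gE]] := word_decomposition tL kK; rewrite -/l in gE.
apply/imsetP; exists (Ordinal (ltn_pmod p l0), [ffun j : 'I_Q => g (p %/ l + j)%N]) => //.
apply: eq_from_tnth => j; rewrite tnth_mktuple /= ffunE -xw.
have jn := ltn_ord j.
rewrite (_ : i + _ = i + 1 + j%:Z); last by rewrite intS addrA.
rewrite xE // gE; last by apply: leq_trans pn; rewrite ltn_add2l.
have pl := ltn_pmod p l0.
rewrite inordK; last first.
  rewrite /Q ltnS; apply: (@leq_trans ((l + n) %/ l)%N).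
    by apply: leq_div2r; rewrite leq_add // ltnW.
  by rewrite divnDl // divnn l0.
rewrite {1 2}(divn_eq p l) -addnA divnMDl // modnMDl //.
Qed.

Lemma tower_zero_entropy (R : realType) (A : finType) (s : nat -> nat)
    (L : nat -> level A) : tower s L ->
  (forall k, ln (#|idx (L k.+1)|%:R : R) <= 2 / k.+1%:R * (len (L k.+1))%:R) ->
  zero_entropy R (tower_subshift L).
Proof.
move=> tL ent; apply/cvgrPdist_le => /= eps eps0.
(* At this level the [n %/ l] blocks contribute at most [eps / 2 * n]; the rest, gathered in [C], is
   independent of [n] and takes the other half. *)
pose k := Num.truncn (4 / eps).
have k4 : 2 / k.+1%:R <= eps / 2.
  have := truncnS_gt (4 / eps); rewrite -/k ltr_pdivrMr // => h.
  by rewrite ler_pdivrMr //; lra.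
set l := len (L k.+1); set T := idx (L k.+1).
have l0 : (0 < l)%N := tower_len_gt0 k.+1 tL.
have T0 : (0 < #|T|)%N := tower_idx_gt0 tL k.+1.
have lR : 0 < l%:R :> R by rewrite ltr0n.
have TR : 0 < #|T|%:R :> R by rewrite ltr0n.
have lnT : 0 <= ln (#|T|%:R : R) by apply: ln_ge0; rewrite ler1n.
have lnl : 0 <= ln (l%:R : R) by apply: ln_ge0; rewrite ler1n.
pose C : R := ln l%:R + 2 * ln #|T|%:R.
have C0 : 0 <= C by rewrite addr_ge0 // mulr_ge0.
exists (Num.truncn (2 * C / eps)).+1 => // n /= nC.
have n0 : (0 < n)%N by apply: leq_ltn_trans nC.
have nR : 0 < n%:R :> R by rewrite ltr0n.
have Cn : C <= eps / 2 * n%:R.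
  have : 2 * C / eps < n%:R.
    by apply: lt_le_trans (truncnS_gt _) _; rewrite ler_nat.
  rewrite ltr_pdivrMr //; lra.
rewrite sub0r normrN.
have lnL : 0 <= ln (#|lang (tower_subshift L) n|%:R : R).
  case: (posnP #|lang (tower_subshift L) n|) => [->|h]; first by rewrite ln0.
  by apply: ln_ge0; rewrite ler1n.
rewrite ger0_norm ?divr_ge0 // ler_pdivrMr //.
case: (posnP #|lang (tower_subshift L) n|) => [->|L0].
  by rewrite ln0 // mulr_ge0 // ltW.
have := @lang_card_le A s L k.+1 n tL; rewrite -(@ler_nat R) -/l -/T => cardL.
apply: (@le_trans _ _ (ln (l * #|T| ^ (n %/ l).+2)%N%:R)).
  by rewrite ler_ln // posrE ltr0n // muln_gt0 l0 expn_gt0 T0.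
rewrite natrM natrX lnM ?posrE ?exprn_gt0 // lnXn //.
have -> : ln (l%:R : R) + ln #|T|%:R *+ (n %/ l).+2 = C + ln #|T|%:R * (n %/ l)%N%:R.
  rewrite -(addn2 (n %/ l)) -[X in ln _ + X]mulr_natr natrD /C; ring.
have : ln (#|T|%:R : R) * (n %/ l)%N%:R <= eps / 2 * n%:R.
  apply: (@le_trans _ _ (2 / k.+1%:R * l%:R * (n %/ l)%N%:R)).
    by apply: ler_wpM2r; [exact: ler0n|exact: ent].
  rewrite -mulrA -natrM; apply: ler_pM => //.
  by rewrite ler_nat mulnC leq_divM.
lra.
Qed.

Theorem theorem1p4 (R : realType) (A : finType) (s : nat -> nat) :
  injective s -> (0 < #|A|)%N -> banach_density_zero R s ->
  exists X : set (int -> A),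
    minimal_subshift X /\ zero_entropy R X /\
    forall u : nat -> A, exists x, X x /\ forall n : nat, x (s n)%:Z = u n.
Proof.
move=> s_inj A0 s0; have [L tL ent] := tower_exists A0 s0.
have /card_gt0P[a0 _] := A0.
exists (tower_subshift L); split; last split.
- apply: (tower_subshift_minimal tL).
  by have [x Xx _] := tower_interpolates (fun=> a0) tL; exists x.
- exact: tower_zero_entropy tL ent.
- move=> u.
  (* Injectivity of [s] makes [u] a well-defined function on the values of [s]; elsewhere the letter
     [a0] is used. *)
  have : forall z : int, exists a, forall n, (s n)%:Z = z -> a = u n.
    move=> z; case: (pselect (hit s z)) => [[t <-]|nz].
      by exists (u t) => n [] /s_inj ->.
    by exists a0 => n nz'; case: nz; exists n.
  move=> /choice[v Hv]; have [x Xx xv] := tower_interpolates v tL.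
  exists x; split => // n; rewrite xv; last by exists n.
  exact: Hv.
Qed.
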